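(* There is an absolute constant $r_0$ such that for every constant $r \ge r_0$ there exist constants $C, C' > 0$ (depending only on $r$) with the following property. Consider an instance of the dynamic multi-processor cup game with parameters $p \ge 1$, $0 < \varepsilon < 1$ and $\delta$ with $C \varepsilon^{-1} p^{-(r-1)} \le \delta < 1$, in which the emptier follows the greedy algorithm. For each step $i$ let $n_i$ be the number of cups present at the end of step $i$, or $p^r$ if that number is less than $p^r$. Then at the end of every step $i$, every cup contains at most $C' \varepsilon^{-1} \max(1,\log n_i)$ units of water.
   Context: Dynamic multi-processor cup game with parameters $p,\varepsilon,\delta$: initially there are no cups. At the beginning of any step the filler may introduce arbitrarily many new empty cups, into each of which it must pour a nonzero amount of water during that step. In each step the filler pours nonnegative amounts of water into the present cups, at most $1-\delta$ into any cup and at most $(1-\varepsilon)p$ in total; then the emptier removes up to one unit of water from each of up to $p$ distinct cups. At the end of each step, all empty cups are removed. Greedy algorithm: each step the emptier removes $\min(1,\text{fill})$ from each of the $p$ fullest cups. *)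

(* Defs.v *)
From mathcomp Require Import all_boot all_order all_algebra.
From mathcomp Require Import finmap.
From mathcomp Require Import all_classical all_reals all_analysis.

Set Implicit Arguments.
Unset Strict Implicit.
Unset Printing Implicit Defensive.

Import Order.TTheory GRing.Theory Num.Theory.

Local Open Scope fset_scope.
Local Open Scope fmap_scope.
Local Open Scope ring_scope.

(* Cups are named by natural numbers; a state maps each cup that is present
   to the amount of water in it.  The name of a cup that has been removed may
   be used again for a new cup. *)
Definition state (R : realType) := {fmap nat -> R}.

Definition cups (R : realType) (s : state R) : {fset nat} := domf s.

Definition fill (R : realType) (s : state R) (c : nat) : R :=
  odflt 0 s.[? c].

(* The moves of both players: [introduced k], [poured k] and [removed k]
   belong to the step that follows the first [k] steps.  Values of [poured k]
   and [removed k] at cups that are not present have no effect. *)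
Record play (R : realType) := Play {
  introduced : nat -> {fset nat};
  poured : nat -> nat -> R;
  removed : nat -> nat -> R
}.

Definition after_filler (R : realType) (s : state R)
    (new : {fset nat}) (pour : nat -> R) : state R :=
  [fmap c : cups s `|` new => fill s (val c) + pour (val c)].

(* Subtract the removed water, then discard the cups that are empty. *)
Definition after_emptier (R : realType) (s : state R)
    (rem : nat -> R) : state R :=
  [fmap c : [fset c in cups s | fill s c - rem c != 0] =>
     fill s (val c) - rem (val c)].

(* [state_after g i] is the state at the end of step [i], steps being numbered
   from 1. *)
Fixpoint state_after (R : realType) (g : play R) (i : nat) : state R :=
  if i is k.+1 then
    after_emptier
      (after_filler (state_after g k) (introduced g k) (poured g k))
      (removed g k)
  else [fmap].

Definition mid_state (R : realType) (g : play R) (k : nat) : state R :=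
  after_filler (state_after g k) (introduced g k) (poured g k).

Definition legal_filling (R : realType) (p : nat) (eps delta : R)
    (s : state R) (new : {fset nat}) (pour : nat -> R) : Prop :=
  [/\ [disjoint cups s & new]%fset,
      forall c, c \in cups s `|` new -> 0 <= pour c <= 1 - delta,
      forall c, c \in new -> pour c != 0
    & \sum_(c <- cups s `|` new) pour c <= (1 - eps) * p%:R].

Definition legal_emptying (R : realType) (p : nat) (s : state R)
    (rem : nat -> R) : Prop :=
  exists S : {fset nat},
    [/\ S `<=` cups s, (#|` S| <= p)%N,
        forall c, c \in S -> 0 <= rem c <= Num.min 1 (fill s c)
      & forall c, c \notin S -> rem c = 0].

(* [S] is a set of [p] fullest cups, ties being broken arbitrarily (all cups
   when there are fewer than [p] of them). *)
Definition p_fullest (R : realType) (p : nat) (s : state R)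
    (S : {fset nat}) : Prop :=
  [/\ S `<=` cups s, #|` S| = minn p #|` cups s|
    & forall c d, c \in S -> d \in cups s `\` S -> fill s d <= fill s c].

Definition greedy_emptying (R : realType) (p : nat) (s : state R)
    (rem : nat -> R) : Prop :=
  exists2 S : {fset nat}, p_fullest p s S
    & forall c, rem c = if c \in S then Num.min 1 (fill s c) else 0.

Definition dynamic_cup_game (R : realType) (p : nat) (eps delta : R)
    (g : play R) : Prop :=
  forall k, legal_filling p eps delta
              (state_after g k) (introduced g k) (poured g k)
            /\ legal_emptying p (mid_state g k) (removed g k).

Definition greedy_emptier (R : realType) (p : nat) (g : play R) : Prop :=
  forall k, greedy_emptying p (mid_state g k) (removed g k).

Definition cup_count (R : realType) (p : nat) (r : R) (g : play R)
    (i : nat) : R :=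
  Num.max (#|` cups (state_after g i)|)%:R (p%:R `^ r).

(* Main.v *)
(* With [phi x = exp (eps * x) - 1], the potential [Phi], the sum of [phi] over
   the fills of all cups, never exceeds [e * (N + p `^ r)], where [N] is the
   number of cups present.  If greedy empties [p] cups all holding more than one
   unit, no cup disappears and [Phi] does not grow, because the water leaves
   cups at least as full as those it is added to.  Otherwise every cup that is
   not emptied holds at most one unit: at most [p] cups disappear, the unemptied
   cups add at most [e * eps * p] to [Phi], and each emptied cup loses at least
   [delta] units net (or all it had), which shrinks its share of [Phi] by a
   factor [1 + eps * delta].  The lower bound on [delta] makes this shrinkage
   pay for both the drop of [N] and the increase of [Phi]. *)
Require Import Defs.
From mathcomp Require Import all_boot all_order all_algebra.
From mathcomp Require Import finmap.
From mathcomp Require Import all_classical all_reals all_analysis.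
From mathcomp Require Import ring lra.

Set Implicit Arguments.
Unset Strict Implicit.
Unset Printing Implicit Defensive.

Import Order.TTheory GRing.Theory Num.Theory.

Local Open Scope ring_scope.

(** * Fills after each of the two moves of a step *)

Lemma fill_notin (R : realType) (s : state R) (c : nat) :
  c \notin cups s -> fill s c = 0.
Proof. by move=> cs; rewrite /fill not_fnd. Qed.

Lemma fill_after_filler (R : realType) (s : state R) (new : {fset nat})
    (pour : nat -> R) (c : nat) :
  c \in (cups s `|` new)%fset ->
  fill (after_filler s new pour) c = fill s c + pour c.
Proof. by move=> cD; rewrite {1}/fill (in_fnd cD) /= ffunE. Qed.

Lemma in_cups_after_emptier (R : realType) (s : state R) (rem : nat -> R)
    (c : nat) :
  (c \in cups (after_emptier s rem))
  = (c \in cups s) && (fill s c - rem c != 0).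
Proof. by rewrite /cups /= !inE. Qed.

Lemma fill_after_emptier (R : realType) (s : state R) (rem : nat -> R)
    (c : nat) :
  c \in cups s -> fill (after_emptier s rem) c = fill s c - rem c.
Proof.
move=> cs; have [cs'|cs'] := boolP (c \in cups (after_emptier s rem)).
  by rewrite {1}/fill (in_fnd cs') /= ffunE.
(* A discarded cup has difference zero, which agrees with the default value of [fill]. *)
rewrite fill_notin//; move: cs'; rewrite in_cups_after_emptier cs/= negbK.
by move/eqP.
Qed.

Lemma exists_fset_min (R : realType) (S : {fset nat}) (f : nat -> R) :
  S != fset0 -> exists2 c, c \in S & forall d, d \in S -> f c <= f d.
Proof.
move=> /fset0Pn [c0 c0S].
pose x0 : S := [` c0S]%fset.
case: (@arg_minP _ R S x0 xpredT (fun x : S => f (val x)) isT) => x _ xmin.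
exists (val x); first exact: valP.
by move=> d dS; exact: (xmin [` dS]%fset).
Qed.

(** * The exponential potential and elementary bounds on [expR] *)

Lemma expR_ge1 (R : realType) (x : R) : 0 <= x -> 1 <= expR x.
Proof. by move=> x0; rewrite -{1}expR0 ler_expR. Qed.

(** Subtracting 1 gives absent cups weight zero, so states before and after a step can be summed
    over one common set of cups. *)
Definition phi (R : realType) (lam x : R) : R := expR (lam * x) - 1.

Definition Phi (R : realType) (lam : R) (s : state R) : R :=
  \sum_(c <- cups s) phi lam (fill s c).

Lemma phi_ge0 (R : realType) (lam x : R) : 0 <= lam -> 0 <= x -> 0 <= phi lam x.
Proof. by move=> l0 x0; rewrite subr_ge0 expR_ge1// mulr_ge0. Qed.

Lemma Phi_widen (R : realType) (lam : R) (s : state R) (D : {fset nat}) :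
  (cups s `<=` D)%fset ->
  Phi lam s = \sum_(c <- D) phi lam (fill s c).
Proof.
move=> sD; rewrite /Phi; apply: big_fset_incl => // c _ cs.
by rewrite fill_notin// /phi mulr0 expR0 subrr.
Qed.

Lemma expRB1_le (R : realType) (x : R) : 1 - expR (- x) <= x.
Proof. by have := expR_ge1Dx (- x); lra. Qed.

(** At [x = eps] the loss [eps * (1 - eps)] per removed unit matches the filler's budget of
    [1 - eps] per processor. *)
Lemma expRN_le (R : realType) (x : R) : 0 <= x -> expR (- x) <= 1 - x * (1 - x).
Proof.
move=> x0; rewrite expRN.
have x1 : 0 < 1 + x by lra.
apply: (@le_trans _ _ (1 + x)^-1).
  by rewrite lef_pV2 ?posrE ?expR_gt0 ?expR_ge1Dx.
rewrite -[leLHS]mul1r ler_pdivrMr//; nra.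
Qed.

(** * Change of the potential in a single step *)

Lemma Phi_step_tall (R : realType) (D S : {fset nat}) (f a : nat -> R) (p : nat)
    (eps : R) :
  (S `<=` D)%fset -> #|` S|%fset = p -> (1 <= p)%N -> 0 < eps < 1 ->
  (forall c, c \in D -> 0 <= a c <= 1) ->
  \sum_(c <- D) a c <= (1 - eps) * p%:R ->
  (forall c d, c \in S -> d \in (D `\` S)%fset ->
    f d + a d <= f c + a c) ->
  \sum_(c <- D) phi eps (f c + a c - (c \in S)%:R)
    <= \sum_(c <- D) phi eps (f c).
Proof.
move=> SD Sp p1 /andP[e0 e1] a01 asum Smax.
have [c0 c0S c0min] : exists2 c, c \in S &
    forall d, d \in S -> f c + a c <= f d + a d.
  by apply: (@exists_fset_min _ _ (fun c => f c + a c)); rewrite -cardfs_gt0 Sp.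
pose M := f c0 + a c0.
(* Every cup is compared at the level [M] of the least full emptied cup; the common weight
   [expR (eps * M)] then factors out of the sum. *)
have cupwise c : c \in D -> phi eps (f c + a c - (c \in S)%:R) - phi eps (f c)
    <= expR (eps * M) * (eps * a c - eps * (1 - eps) * (c \in S)%:R).
  move=> cD; have /andP[ac0 ac1] := a01 c cD.
  have fE : expR (eps * f c) = expR (eps * (f c + a c)) * expR (- (eps * a c)).
    by rewrite -expRD; congr expR; ring.
  have aE := expRB1_le (eps * a c).
  rewrite /phi; have [cS|cS] := boolP (c \in S) => /=.
    have -> : expR (eps * (f c + a c - 1))
        = expR (eps * (f c + a c)) * expR (- eps).
      by rewrite -expRD; congr expR; ring.
    have MX : expR (eps * M) <= expR (eps * (f c + a c)).
      by rewrite ler_expR ler_wpM2l ?c0min// ltW.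
    (* As [a c <= 1], the change of an emptied cup is nonpositive, so its factor may be lowered to
       [expR (eps * M)]. *)
    have le1 : expR (- eps) <= expR (- (eps * a c)) by rewrite ler_expR; nra.
    have := expRN_le (ltW e0); have := expR_gt0 (eps * M).
    rewrite fE; nra.
  have XM : expR (eps * (f c + a c)) <= expR (eps * M).
    by rewrite ler_expR ler_wpM2l ?Smax// ?ltW// in_fsetD cS.
  have le1 : expR (- (eps * a c)) <= 1 by rewrite -expR0 ler_expR; nra.
  have := expR_gt0 (eps * M).
  rewrite subr0 fE; nra.
rewrite -subr_le0 -sumrB.
have SE : \sum_(c <- D) (c \in S)%:R = p%:R :> R.
  rewrite -(big_fset_incl _ SD) /=; last by move=> c _ /negPf ->.
  rewrite big_seq (eq_bigr (fun=> 1)); last by move=> c ->.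
  by rewrite -big_seq big_const_seq count_predT iter_addr_0 -Sp.
apply: (@le_trans _ _ (\sum_(c <- D)
    expR (eps * M) * (eps * a c - eps * (1 - eps) * (c \in S)%:R))).
  by rewrite big_seq [leRHS]big_seq; apply: ler_sum => c; exact: cupwise.
rewrite -mulr_sumr sumrB -!mulr_sumr SE.
apply: mulr_ge0_le0; first exact: expR_ge0.
by rewrite -mulrA -mulrBr pmulr_rle0// subr_le0.
Qed.

(** The inequality holds cup by cup. Emptied cups absorb the factor [1 + eps * delta]. For the
    others, the two error terms bound the growth by pouring and the extra [eps * delta] share of a
    [phi] that is at most [expR 1 * eps]. *)
Lemma Phi_step_short (R : realType) (D S : {fset nat}) (f a : nat -> R)
    (eps delta : R) :
  0 < eps < 1 -> 0 < delta ->
  (forall c, c \in D -> 0 <= f c) ->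
  (forall c, c \in D -> 0 <= a c <= 1 - delta) ->
  (forall c, c \in D -> c \notin S -> f c + a c <= 1) ->
  (1 + eps * delta) * \sum_(c <- D)
      phi eps (f c + a c - (if c \in S then Num.min 1 (f c + a c) else 0))
    <= \sum_(c <- D) phi eps (f c)
       + expR 1 * eps * \sum_(c <- D) a c
       + expR 1 * eps * eps * delta * #|` (D `\` S)|%fset%:R.
Proof.
move=> /andP[e0 e1] d0 f0 a01 short.
have -> : #|` (D `\` S)|%fset%:R = \sum_(c <- D) (c \notin S)%:R :> R.
  rewrite -(@big_fset_incl _ _ _ _ (D `\` S)%fset) ?fsubsetDl//=; last first.
    by move=> c cD; rewrite in_fsetD cD andbT negbK => ->.
  rewrite big_seq (eq_bigr (fun=> 1)); last by move=> c; rewrite in_fsetD => /andP[->].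
  by rewrite -big_seq big_const_seq count_predT iter_addr_0.
rewrite !mulr_sumr -!big_split /= big_seq [leRHS]big_seq.
apply: ler_sum => c cD.
have fc0 := f0 c cD; have /andP[ac0 ac1] := a01 c cD.
have e1gt0 := @expR_gt0 R 1.
have [cS|cS] /= := boolP (c \in S).
  have rhs : phi eps (f c)
      <= phi eps (f c) + expR 1 * eps * a c + expR 1 * eps * eps * delta * 0.
    by rewrite mulr0 addr0 lerDl !mulr_ge0// ltW.
  apply: le_trans rhs.
  have [x1|x1] := leP 1 (f c + a c); last first.
    by rewrite subrr {1}/phi mulr0 expR0 subrr mulr0 phi_ge0// ltW.
  rewrite /phi.
  have E1 : 1 <= expR (eps * (f c + a c - 1)).
    by apply: expR_ge1; nra.
  have -> : expR (eps * f c)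
      = expR (eps * (f c + a c - 1)) * expR (eps * (1 - a c)).
    by rewrite -expRD; congr expR; ring.
  (* A whole unit leaves and at most [1 - delta] came in, so the exponent drops by at least
     [eps * delta]. *)
  have := expR_ge1Dx (eps * (1 - a c)).
  have : eps * delta <= eps * (1 - a c) by rewrite ler_pM2l//; lra.
  have : 0 < eps * delta by rewrite mulr_gt0.
  nra.
have x1 := short c cD cS.
rewrite subr0 mulr1 /phi.
have fE : expR (eps * f c) = expR (eps * (f c + a c)) * expR (- (eps * a c)).
  by rewrite -expRD; congr expR; ring.
have Xe : expR (eps * (f c + a c)) <= expR 1 by rewrite ler_expR; nra.
have X0 := expR_gt0 (eps * (f c + a c)).
have grow : expR (eps * (f c + a c)) - expR (eps * f c) <= expR 1 * (eps * a c).
  rewrite fE; have := expRB1_le (eps * a c).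
  have : 0 <= eps * a c by rewrite mulr_ge0// ltW.
  nra.
(* This is [1 - expR (- y) <= y] multiplied by [expR y], with [y <= eps]. *)
have small : expR (eps * (f c + a c)) - 1 <= expR 1 * eps.
  have /(ler_wpM2l (ltW X0)) := expRB1_le (eps * (f c + a c)).
  rewrite mulrBr mulr1 -expRD subrr expR0.
  have : eps * (f c + a c) <= eps by nra.
  nra.
have /(ler_wpM2l (ltW (mulr_gt0 e0 d0))) := small.
nra.
Qed.

(** * The invariant along a play *)

Lemma fill_step (R : realType) (g : play R) (k c : nat) :
  c \in (cups (state_after g k) `|` introduced g k)%fset ->
  fill (state_after g k.+1) c
  = fill (state_after g k) c + poured g k c - removed g k c.
Proof. by move=> cD; rewrite /= fill_after_emptier ?fill_after_filler. Qed.

Lemma fill_gt0 (R : realType) (p : nat) (eps delta : R) (g : play R) :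
  dynamic_cup_game p eps delta g ->
  forall k c, c \in cups (state_after g k) -> 0 < fill (state_after g k) c.
Proof.
move=> game; elim=> [|k IH] c; first by rewrite /cups /= inE.
rewrite /state_after -/state_after in_cups_after_emptier => /andP[cD].
rewrite fill_after_emptier// lt0r => ->/=.
have [_ [S [SD _ remS remNS]]] := game k.
have [cS|cS] := boolP (c \in S).
  by have /andP[_] := remS _ cS; rewrite le_min subr_ge0 => /andP[].
rewrite remNS// subr0 fill_after_filler//.
have [[_ /(_ c cD)/andP[a0 _] _ _] _] := game k.
apply: addr_ge0 => //; have [cs|cs] := boolP (c \in cups (state_after g k)).
  exact/ltW/IH.
by rewrite fill_notin.
Qed.

(** [P] stands for [p ^ r]. Of the [2 * p%:R], one half pays for vanishing cups, the other for
    poured water. *)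
Lemma Phi_bound (R : realType) (p : nat) (eps delta P : R) (g : play R) :
  (1 <= p)%N -> 0 < eps < 1 -> 0 < delta -> 0 <= P ->
  2 * p%:R <= eps * delta * P ->
  dynamic_cup_game p eps delta g -> greedy_emptier p g ->
  forall k, Phi eps (state_after g k)
    <= expR 1 * (#|` cups (state_after g k)|%fset%:R + P).
Proof.
move=> p1 e01 d0 P0 pP game greedy; have /andP[e0 e1] := e01.
elim=> [|k IH].
  by rewrite /Phi /cups /= big_seq_fset0 mulr_ge0// ?expR_ge0// addr_ge0.
have fpos := @fill_gt0 _ _ _ _ _ game k.
have [[_ a01 newpos asum] _] := game k.
have [S [SD Scard Smax] remE] := greedy k.
set s := state_after g k in IH fpos a01 newpos asum *.
set a := poured g k in a01 newpos asum.
set D := (cups s `|` introduced g k)%fset.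
have cupsD : cups (mid_state g k) = D by [].
rewrite cupsD in SD Scard Smax.
have midE c : c \in D -> fill (mid_state g k) c = fill s c + a c.
  exact: fill_after_filler.
have f0 c : 0 <= fill s c.
  by have [/fpos/ltW//|/fill_notin->] := boolP (c \in cups s).
(* New cups receive a nonzero amount, so a cup that is not emptied cannot vanish. *)
have mid_gt0 c : c \in D -> 0 < fill s c + a c.
  move=> cD; have /andP[a0 _] := a01 c cD.
  have [cs|cs] := boolP (c \in cups s); first by rewrite ltr_pwDl ?fpos.
  rewrite ltr_wpDl// lt0r a0 newpos//.
  by move: cD; rewrite /D in_fsetU (negPf cs).
have sD : (cups s `<=` D)%fset by exact: fsubsetUl.
have s'D : (cups (state_after g k.+1) `<=` D)%fset.
  apply/fsubsetP => c; rewrite /state_after -/state_after.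
  by rewrite in_cups_after_emptier => /andP[].
have stay c : c \in D -> removed g k c < fill s c + a c ->
    c \in cups (state_after g k.+1).
  move=> cD lt; rewrite /state_after -/state_after in_cups_after_emptier.
  by rewrite cD/= midE// subr_eq0 gt_eqF.
have PhiE : Phi eps (state_after g k.+1)
    = \sum_(c <- D) phi eps (fill s c + a c - removed g k c).
  rewrite (Phi_widen _ s'D) !big_seq; apply: eq_bigr => c cD.
  by rewrite fill_step.
rewrite (Phi_widen _ sD) in IH.
have remNS c : c \notin S -> removed g k c = 0.
  by move=> cS; rewrite remE (negPf cS).
have [/andP[/eqP Sp /allP tall]|] :=
    boolP ((#|` S|%fset == p) && all (fun c => 1 < fill s c + a c) S).
  have remS c : removed g k c = (c \in S)%:R.
    rewrite remE; case: ifPn => // cS.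
    by rewrite midE ?(fsubsetP SD)// min_l// ltW// tall.
  have sub : (cups s `<=` cups (state_after g k.+1))%fset.
    apply/fsubsetP => c /(fsubsetP sD) cD; apply: stay => //.
    rewrite remS; have [cS|cS] := boolP (c \in S); first exact: tall.
    exact: mid_gt0.
  rewrite PhiE; under eq_bigr do rewrite remS.
  apply: (le_trans (Phi_step_tall SD Sp p1 e01 _ asum _)).
  - by move=> c /a01/andP[-> ac1]/=; apply: (le_trans ac1); lra.
  - move=> c d cS dD; rewrite -!midE ?Smax//.
      exact: (fsubsetP SD).
    by move: dD; rewrite in_fsetD => /andP[].
  - apply: (le_trans IH); rewrite ler_pM2l ?expR_gt0// lerD2r ler_nat.
    exact: fsubset_leq_card.
move=> short.
have {}short c : c \in D -> c \notin S -> fill s c + a c <= 1.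
  move=> cD cS; move: short; rewrite negb_and => /orP[Sp|].
    (* With fewer than [p] cups present, greedy empties from all of them. *)
    suff SeqD : S = D by rewrite SeqD cD in cS.
    apply/eqP; rewrite eqEfcard SD/= Scard.
    by move: Sp; rewrite Scard /minn; case: ltnP => //; rewrite eqxx.
  (* Some emptied cup [d] holds at most one unit, and no unemptied cup is fuller than [d]. *)
  move=> /allPn[d dS]; rewrite -leNgt; apply: le_trans.
  by rewrite -!midE ?(fsubsetP SD d)// Smax// in_fsetD cS.
have := Phi_step_short e01 d0 (fun c _ => f0 c) a01 short.
have -> : \sum_(c <- D) phi eps (fill s c + a c -
      (if c \in S then Num.min 1 (fill s c + a c) else 0))
    = Phi eps (state_after g k.+1).
  rewrite PhiE !big_seq; apply: eq_bigr => c cD.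
  by rewrite remE midE.
have sub : (#|` D `\` S| <= #|` cups (state_after g k.+1)|)%fset%N.
  apply/fsubset_leq_card/fsubsetP => c; rewrite in_fsetD => /andP[cS cD].
  by apply: stay => //; rewrite remNS// mid_gt0.
have drop : (#|` cups s| <= #|` D `\` S| + p)%fset%N.
  apply: (leq_trans (fsubset_leq_card sD)).
  rewrite -(cardfsID S D) addnC leq_add2l (fsetIidPr SD) Scard.
  exact: geq_minl.
move: sub drop IH; rewrite -(ler_nat R) => sub; rewrite -(ler_nat R) natrD.
move: sub.
set N' := #|` cups (state_after g k.+1)|%fset%:R.
set N := #|` cups s|%fset%:R.
set n := #|` D `\` S|%fset%:R.
set F := Phi _ _; set F0 := \sum_(c <- D) _; set E := expR 1.
move=> nN' Nn IH step.
have E0 : 0 < E by exact: expR_gt0.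
have n0 : 0 <= n by exact: ler0n.
have ed0 : 0 < eps * delta by rewrite mulr_gt0.
(* The number [n] of unemptied cups serves both as a lower bound for the new count and, up to [p],
   as an upper bound for the old one. *)
apply: (@le_trans _ _ (E * (n + P))); last by rewrite ler_pM2l// lerD2r.
rewrite -(@ler_pM2l _ (1 + eps * delta)); last by lra.
apply: (le_trans step).
have asum' : \sum_(c <- D) a c <= p%:R.
  apply: (le_trans asum); have : 0 <= p%:R :> R by exact: ler0n.
  nra.
have p0 : 0 <= p%:R :> R by exact: ler0n.
(* The summands cover, in order, the old potential, the poured water and the unemptied cups; the
   last is the slack in the hypothesis on [P]. *)
have -> : (1 + eps * delta) * (E * (n + P)) =
   E * (n + p%:R + P) + E * p%:R + E * (eps * delta) * n
   + E * (eps * delta * P - 2 * p%:R) by ring.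
have t1 : E * (N + P) <= E * (n + p%:R + P) by rewrite ler_pM2l// lerD2r.
have t2 : E * eps * (\sum_(c <- D) a c) <= E * p%:R.
  rewrite -mulrA ler_pM2l//.
  apply: (@le_trans _ _ (eps * p%:R)); first by rewrite ler_pM2l.
  nra.
have t3 : E * eps * eps * delta * n <= E * (eps * delta) * n.
  have -> : E * eps * eps * delta * n = eps * (E * (eps * delta) * n) by ring.
  have : 0 <= E * (eps * delta) * n by rewrite !mulr_ge0// ltW.
  nra.
have t4 : 0 <= E * (eps * delta * P - 2 * p%:R).
  by rewrite mulr_ge0 ?subr_ge0 // ltW.
lra.
Qed.

(** * From the potential to the fill of a single cup *)

Theorem theorem7p3 (R : realType) :
  exists r0 : R, forall r : R, r0 <= r ->
  exists C C' : R, [/\ 0 < C, 0 < C' &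
    forall (p : nat) (eps delta : R) (g : play R),
      (1 <= p)%N -> 0 < eps < 1 ->
      C * eps^-1 * p%:R `^ (- (r - 1)) <= delta < 1 ->
      dynamic_cup_game p eps delta g ->
      greedy_emptier p g ->
      forall i c : nat, (1 <= i)%N -> c \in cups (state_after g i) ->
        fill (state_after g i) c
          <= C' * eps^-1 * Num.max 1 (ln (cup_count p r g i))].
Proof.
(* [0 <= r] ensures [p ^ r >= 1]; 2 is the factor in [Phi_bound]; 4 comes from
   [3 + ln n <= 4 * max(1, ln n)]. *)
exists 0 => r r0; exists 2, 4; split=> // p eps delta g p1 e01.
move=> /andP[dC d1] game greedy i c _ cs.
have /andP[e0 e1] := e01.
have p0 : 0 < p%:R :> R by rewrite ltr0n.
have d0 : 0 < delta.
  by apply: lt_le_trans dC; rewrite !mulr_gt0 ?invr_gt0 ?powR_gt0.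
pose P : R := p%:R `^ r.
have P1 : 1 <= P.
  by rewrite -(powRr0 (p%:R : R)); apply: ler_powR => //; rewrite ler1n.
have pP : 2 * p%:R <= eps * delta * P.
  have pE : p%:R = p%:R `^ (- (r - 1)) * P.
    rewrite -powRD; last by apply/implyP => _; rewrite gt_eqF.
    by rewrite (_ : _ + r = 1) ?powRr1 ?ler0n//; ring.
  have -> : 2 * p%:R = eps * (2 * eps^-1 * p%:R `^ (- (r - 1))) * P.
    by rewrite [in LHS]pE; field; rewrite gt_eqF.
  by rewrite ler_wpM2r ?ler_wpM2l// ?ltW//; apply: lt_le_trans P1.
have := Phi_bound p1 e01 d0 (le_trans ler01 P1) pP game greedy i.
set n := cup_count p r g i.
have Nn : #|` cups (state_after g i)|%fset%:R <= n by rewrite le_max lexx.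
have Pn : P <= n by rewrite le_max lexx orbT.
have n1 : 1 <= n by exact: le_trans Pn.
have fpos := @fill_gt0 _ _ _ _ _ game i.
set f := fill _ c => bound.
have single : phi eps f <= Phi eps (state_after g i).
  rewrite /Phi (big_fsetD1 c)//= lerDl big_seq sumr_ge0// => d.
  by rewrite in_fsetD => /andP[_ /fpos/ltW ?]; rewrite phi_ge0// ltW.
have E1 : 1 <= expR 1 :> R by exact: expR_ge1.
have E2 : 3 <= expR 2 :> R by apply: le_trans (expR_ge1Dx _); lra.
(* The potential is at most [2 * e * n]; adding back the 1 from [phi] gives at most [3 * e * n], and
   [3 <= e ^ 2]. *)
have fn : expR (eps * f) <= expR (3 + ln n).
  have -> : 3 + ln n = 1 + 2 + ln n by ring.
  rewrite 2!expRD lnK ?posrE; last by lra.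
  apply: (@le_trans _ _ (expR 1 * 3 * n)).
    have : expR 1 * (#|` cups (state_after g i)|%fset%:R + P)
        <= expR 1 * (2 * n) by rewrite ler_pM2l ?expR_gt0//; lra.
    have : 1 <= expR 1 * n by nra.
    move: single bound; rewrite /phi; lra.
  by rewrite ler_wpM2r ?ler_wpM2l//; lra.
move: fn; rewrite ler_expR => fn.
have M1 : 1 <= Num.max 1 (ln n) by rewrite le_max lexx.
have Mn : ln n <= Num.max 1 (ln n) by rewrite le_max lexx orbT.
rewrite -mulrA mulrCA -(ler_pM2l e0) mulVKf ?gt_eqF//.
lra.
Qed.
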